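(* Let $X_1, \dots, X_m$ be random variables defined on a probability space $(\Omega, \mathscr{F}, \Pr)$ and let $a_i, b_i$ ($i = 1, \dots, m$) be real numbers. Let $u_i, v_i, \alpha_i, \beta_i$ be real numbers such that $$\Pr\{X_i \leq u_i\} \leq \alpha_i, \qquad \Pr\{X_i \geq v_i\} \leq \beta_i$$ for $i = 1, \dots, m$. Let $$a_i' = \max(a_i, u_i), \qquad b_i' = \min(b_i, v_i), \qquad i = 1, \dots, m,$$ and let $$P = \Pr\{a_i < X_i < b_i, \; i = 1, \dots, m\}, \qquad P' = \Pr\{a_i' < X_i < b_i', \; i = 1, \dots, m\}.$$ Then $$P' \leq P \leq P' + \sum_{i=1}^m (\alpha_i + \beta_i).$$
   Context: The random variables $X_1,\dots,X_m$ are real-valued and are not assumed independent. The event $\{a_i < X_i < b_i,\ i=1,\dots,m\}$ means that the inequalities hold simultaneously for all $i$. *)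

(* Defs.v *)
From mathcomp Require Export all_boot all_order all_algebra.
From mathcomp Require Export all_classical all_reals all_analysis.

(* Main.v *)
Require Import Defs.
Import Order.TTheory GRing.Theory Num.Theory.
Local Open Scope classical_set_scope.
Local Open Scope ring_scope.

(** Write [E] for the event that every [X i] lies in the wide interval
    [(a i, b i)] and [E'] for the event that every [X i] lies in the narrowed
    interval [(max (a i) (u i), min (b i) (v i))].  Being above a maximum is
    being above both terms, and dually for the minimum, so [E'] is exactly the
    part of [E] on which no [X i] falls in one of its tails [X i <= u i],
    [X i >= v i].

    Hence [E'] is contained in [E], and an outcome of [E] outside [E'] lies in
    one of the [2 m] tail events.  Monotonicity of the measure gives the lower
    bound; the union bound ([measure_bigcup_fin_le]), which holds whatever the
    dependence between the variables, gives the upper one. *)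

(** The union bound.  Indexing by a finite type rather than by an initial segment of
    the natural numbers lets it apply to a family over ['I_m] as is, with no
    extension of the family to a sequence. *)
Lemma measure_bigcup_fin_le {R : realType} {d : measure_display}
    {T : measurableType d} (mu : {measure set T -> \bar R})
    (I : finType) (F : I -> set T) :
  (forall i, measurable (F i)) ->
  (mu (\bigcup_i F i) <= \sum_i mu (F i))%E.
Proof.
move=> mF.
have -> : \bigcup_i F i = \big[setU/set0]_i F i.
  rewrite -bigcup_seq; apply: eq_bigcupl; split=> // i _ /=.
  exact: mem_index_enum.
(* Measurability of the partial unions is carried along, since each use of
   binary subadditivity needs it. *)
suff [] : measurable (\big[setU/set0]_i F i) /\
          (mu (\big[setU/set0]_i F i) <= \sum_i mu (F i))%E by [].
apply: (big_ind2 (fun A x => measurable A /\ (mu A <= x)%E)).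
- by rewrite measure0; split.
- move=> A x B y [mA leAx] [mB leBy]; split; first exact: measurableU.
  exact: le_trans (measureU2 mu mA mB) (leeD leAx leBy).
- by move=> i _; split.
Qed.

Lemma measurable_box {R : realType} {d : measure_display}
    {T : measurableType d} (I : finType) (X : I -> {mfun T >-> R})
    (a b : I -> R) :
  measurable [set w | forall i, a i < X i w < b i].
Proof.
have -> : [set w | forall i, a i < X i w < b i] =
          \bigcap_i (X i @^-1` `]a i, b i[%classic).
  apply/seteqP; split=> w /= h i; first by rewrite /= in_itv /= h.
  by move: (h i Logic.I) => /=; rewrite in_itv.
apply: fin_bigcap_measurable => // i _; rewrite -[_ @^-1` _]setTI.
exact: measurable_funPT.
Qed.

Lemma measurable_lower_tail {R : realType} {d : measure_display}
    {T : measurableType d} (X : {mfun T >-> R}) (t : R) :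
  measurable [set w | X w <= t].
Proof.
have -> : [set w | X w <= t] = setT `&` X @^-1` `]-oo, t]%classic.
  by apply/seteqP; split=> w /=; rewrite in_itv /= => // -[].
exact: measurable_funPT.
Qed.

Lemma measurable_upper_tail {R : realType} {d : measure_display}
    {T : measurableType d} (X : {mfun T >-> R}) (t : R) :
  measurable [set w | X w >= t].
Proof.
have -> : [set w | X w >= t] = setT `&` X @^-1` `[t, +oo[%classic.
  by apply/seteqP; split=> w /=; rewrite in_itv /= andbT => // -[].
exact: measurable_funPT.
Qed.

Theorem theorem1 (R : realType) (d : measure_display) (T : measurableType d)
    (Pr : probability T R) (m : nat) (X : 'I_m -> {RV Pr >-> R})
    (a b u v alpha beta : 'I_m -> R)
    (hu : forall i : 'I_m, (Pr [set w | (X i w <= u i)%R] <= (alpha i)%:E)%E)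
    (hv : forall i : 'I_m, (Pr [set w | (X i w >= v i)%R] <= (beta i)%:E)%E) :
  let a' := fun i : 'I_m => Num.max (a i) (u i) in
  let b' := fun i : 'I_m => Num.min (b i) (v i) in
  let P := Pr [set w | forall i : 'I_m, a i < X i w < b i] in
  let P' := Pr [set w | forall i : 'I_m, a' i < X i w < b' i] in
  (P' <= P)%E /\
  (P <= P' + (\sum_(i < m) (alpha i + beta i))%:E)%E.
Proof.
move=> a' b' P P'.
have narrowE i w : (a' i < X i w < b' i) =
    (a i < X i w < b i) && (u i < X i w < v i).
  by rewrite gt_max lt_min andbACA.
pose tail i := [set w | X i w <= u i] `|` [set w | X i w >= v i].
have mE' : measurable [set w | forall i, a' i < X i w < b' i].
  exact: measurable_box.
have mE : measurable [set w | forall i, a i < X i w < b i].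
  exact: measurable_box.
have mlow i : measurable [set w | X i w <= u i].
  exact: measurable_lower_tail.
have mupp i : measurable [set w | X i w >= v i].
  exact: measurable_upper_tail.
have mtail i : measurable (tail i) by exact: measurableU.
have mtails : measurable (\bigcup_i tail i) by exact: fin_bigcup_measurable.
split.
  apply: le_measure; rewrite ?inE // => w /= h i.
  by have := h i; rewrite narrowE => /andP[].
have cover : [set w | forall i, a i < X i w < b i] `<=`
    [set w | forall i, a' i < X i w < b' i] `|` \bigcup_i tail i.
  move=> w /= Ew.
  case: (pselect (exists i, tail i w)) => [[i ti]|notail].
    by right; exists i.
  left=> i; rewrite narrowE Ew /= !ltNge -negb_or; apply/negP => /orP ti.
  by apply: notail; exists i.
apply: (@le_trans _ _ (Pr ([set w | forall i, a' i < X i w < b' i]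
                           `|` \bigcup_i tail i))).
  by apply: le_measure; rewrite ?inE //; exact: measurableU.
apply: (le_trans (measureU2 Pr mE' mtails)); apply: leeD2l.
apply: (le_trans (measure_bigcup_fin_le Pr _ _ mtail)).
rewrite -sumEFin; apply: lee_sum => i _; rewrite EFinD.
exact: le_trans (measureU2 Pr (mlow i) (mupp i)) (leeD (hu i) (hv i)).
Qed.
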